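(* Let $\mathcal{C}$ be the free cartesian category with a family of conjunctive relevant endofunctors $\{E^i\mid i\in\mathcal{I}\}$ generated by a set of generating objects. Then the functor $G$ from $\mathcal{C}$ to the category $\mathit{Rel}$ of relations between finite ordinals is faithful; i.e. for all arrows $f,g:A\to B$ of $\mathcal{C}$, if $Gf=Gg$, then $f=g$ in $\mathcal{C}$.
   Context: A symmetric monoidal category has a bifunctor $\otimes$, a unit object $I$, and natural isomorphisms with components $a_{A,B,C}:(A\otimes B)\otimes C\to A\otimes(B\otimes C)$, $l_A:I\otimes A\to A$, $r_A:A\otimes I\to A$, $c_{A,B}:A\otimes B\to B\otimes A$, satisfying Mac Lane's coherence conditions (pentagon, triangle, hexagon, $c_{B,A}\circ c_{A,B}=\mathbf{1}_{A\otimes B}$). A conjunctive relevant category is a symmetric monoidal category with a natural transformation $\Delta_A:A\to A\otimes A$ such that $a_{A,A,A}\circ(\Delta_A\otimes\mathbf{1}_A)\circ\Delta_A=(\mathbf{1}_A\otimes\Delta_A)\circ\Delta_A$; $l_I\circ\Delta_I=\mathbf{1}_I$; $c_{A,A}\circ\Delta_A=\Delta_A$; $\Delta_{A\otimes B}=c^m_{A,A,B,B}\circ(\Delta_A\otimes\Delta_B)$, where $c^m_{A,B,C,D}=a^{-1}_{A,C,B\otimes D}\circ(\mathbf{1}_A\otimes(a_{C,B,D}\circ(c_{B,C}\otimes\mathbf{1}_D)\circ a^{-1}_{B,C,D}))\circ a_{A,B,C\otimes D}$. A cartesian category is a conjunctive relevant category in which $I$ is a terminal object; the unique arrow from $A$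 to $I$ is written here $t_A:A\to I$. (Equivalently, a category with all finite products, $\otimes$ being binary product.) A conjunctive relevant endofunctor is an endofunctor $E$ together with a natural transformation $\psi_{A,B}:EA\otimes EB\to E(A\otimes B)$ and an arrow $\psi_0:I\to EI$ such that (1) $Ea_{A,B,C}\circ\psi_{A\otimes B,C}\circ(\psi_{A,B}\otimes\mathbf{1}_{EC})=\psi_{A,B\otimes C}\circ(\mathbf{1}_{EA}\otimes\psi_{B,C})\circ a_{EA,EB,EC}$; (2) $El_A\circ\psi_{I,A}\circ(\psi_0\otimes\mathbf{1}_{EA})=l_{EA}$; (3) $Er_A\circ\psi_{A,I}\circ(\mathbf{1}_{EA}\otimes\psi_0)=r_{EA}$; (4) $Ec_{A,B}\circ\psi_{A,B}=\psi_{B,A}\circ c_{EA,EB}$; (5) $E\Delta_A=\psi_{A,A}\circ\Delta_{EA}$. (No preservation of $t$ by $E$, such as $Et_A=\psi_0\circ t_{EA}$, is assumed.) The category $\mathcal{C}$: fix two arbitrary sets, one of generating objects (propositional letters) and one of generating functors $\{E^i\mid i\in\mathcal{I}\}$; together these are the generators. Objects are the formulae built from the letters and the constant $I$ with the binary connective $\otimes$ and the unary connectives $E^i$. Arrows are equivalence classes of arrow terms built from $\mathbf{1}_A$, $a_{A,B,C}$, $l_A$, $r_A$, their inverses, $c_{A,B}$, $\Delta_A$, $t_A$, and $\psi^i_{A,B}$, $\psi^i_0$ (for each $i\in\mathcal{I}$) with the operations $\circ$, $\otimes$ and $E^i$, modulo the smallest congruence for which the equations of cartesian categories hold and each $(E^i,\psi^i,\psi^i_0)$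 is a conjunctive relevant endofunctor. Superscripts $i$ are omitted below. The functor $G$: $\mathit{Rel}$ has as objects the finite ordinals $n=\{0,\dots,n-1\}$ and as arrows binary relations. $GA$ is the number of occurrences of generators (letters and functors $E^i$) in $A$, numbered $0,1,\dots$ from left to right. The following are functions regarded as relations: $G$ of $\mathbf{1}$, $a$, $l$, $r$ (and inverses) is an identity; $Gc_{A,B}$ maps $k\mapsto GB+k$ for $k<GA$ and $GA+k\mapsto k$ for $k<GB$; $G\psi_{A,B}:1+GA+1+GB\to 1+GA+GB$ maps $0\mapsto 0$, $1+k\mapsto 1+k$ for $k<GA$, $GA+1\mapsto 0$, and $GA+2+k\mapsto 1+GA+k$ for $k<GB$; $G\psi_0$ is the empty function from $0$ to $1$. $G\Delta_A\subseteq GA\times(GA+GA)$ is $\{(k,k),(k,GA+k)\mid k<GA\}$; $Gt_A$ is the empty relation between $GA$ and $0$; $G(f\otimes g)$ is $Gf$ and $Gg$ placed side by side (disjoint sum); $GEf=\{(0,0)\}\cup\{(1+k,1+m)\mid (k,m)\in Gf\}$; $G(g\circ f)$ is the composition of the relations $Gf$ and $Gg$.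
   Formalization: The listed axioms of a cartesian category do not make Δ the diagonal, and with them alone G is not faithful; the equations l_A∘(t_A⊗1_A)∘Δ_A = 1_A and r_A∘(1_A⊗t_A)∘Δ_A = 1_A are added, so that ⊗ is the binary product with diagonal Δ. *)

(* Defs.v *)
From HB Require Import structures.
From mathcomp Require Import all_boot.
From mathcomp Require Import boolp.

Set Implicit Arguments.
Unset Strict Implicit.
Unset Printing Implicit Defensive.

Record category := Category {
  obj : Type;
  hom : obj -> obj -> Type;
  idc : forall A, hom A A;
  compc : forall A B C, hom B C -> hom A B -> hom A C;
  compcA : forall A B C D (h : hom C D) (g : hom B C) (f : hom A B),
    compc h (compc g f) = compc (compc h g) f;
  comp1c : forall A B (f : hom A B), compc (idc B) f = f;
  compc1 : forall A B (f : hom A B), compc f (idc A) = f }.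

Record functor (C D : category) := Functor {
  fobj : obj C -> obj D;
  fmap : forall A B : obj C, hom A B -> hom (fobj A) (fobj B);
  fmap1 : forall A : obj C, fmap (idc A) = idc (fobj A);
  fmapM : forall (A B C' : obj C) (g : hom B C') (f : hom A B),
    fmap (compc g f) = compc (fmap g) (fmap f) }.

Definition faithful (C D : category) (F : functor C D) :=
  forall (A B : obj C) (f g : hom A B), fmap F f = fmap F g -> f = g.

Definition rel_id n : {set 'I_n * 'I_n} := [set p | p.1 == p.2].

Definition rel_comp m n p (S : {set 'I_n * 'I_p}) (R : {set 'I_m * 'I_n}) :
    {set 'I_m * 'I_p} :=
  [set q | [exists k, ((q.1, k) \in R) && ((k, q.2) \in S)]].

Definition rel_sum m n m' n' (R : {set 'I_m * 'I_n})
    (S : {set 'I_m' * 'I_n'}) : {set 'I_(m + m') * 'I_(n + n')} :=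
  [set (lshift m' p.1, lshift n' p.2) | p in R]
  :|: [set (rshift m p.1, rshift n p.2) | p in S].

Definition rel_up m n (R : {set 'I_m * 'I_n}) : {set 'I_m.+1 * 'I_n.+1} :=
  (ord0, ord0) |: [set (lift ord0 p.1, lift ord0 p.2) | p in R].

Definition rel_fun m n (h : nat -> nat) : {set 'I_m * 'I_n} :=
  [set p : 'I_m * 'I_n | h p.1 == p.2 :> nat].

Lemma rel_compA m n p q (T : {set 'I_p * 'I_q}) (S : {set 'I_n * 'I_p})
    (R : {set 'I_m * 'I_n}) :
  rel_comp T (rel_comp S R) = rel_comp (rel_comp T S) R.
Proof.
apply/setP=> -[x y]; rewrite !inE /=; apply/existsP/existsP.
- move=> [k]; rewrite inE /= => /andP[/existsP[j /andP[xj jk]] ky].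
  by exists j; rewrite xj inE /=; apply/existsP; exists k; rewrite jk.
- move=> [j]; rewrite inE /= => /andP[xj /existsP[k /andP[jk ky]]].
  by exists k; rewrite ky inE andbT /=; apply/existsP; exists j; rewrite xj.
Qed.

Lemma rel_comp1 m n (R : {set 'I_m * 'I_n}) : rel_comp (rel_id n) R = R.
Proof.
apply/setP=> -[x y]; rewrite !inE /=; apply/existsP/idP.
- by move=> [k]; rewrite inE /= => /andP[xk /eqP<-].
- by move=> xy; exists y; rewrite xy inE /=.
Qed.

Lemma rel_1comp m n (R : {set 'I_m * 'I_n}) : rel_comp R (rel_id m) = R.
Proof.
apply/setP=> -[x y]; rewrite !inE /=; apply/existsP/idP.
- by move=> [k]; rewrite inE /= => /andP[/eqP-> xk].
- by move=> xy; exists x; rewrite xy inE /= eqxx.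
Qed.

Definition Rel : category :=
  Category rel_compA rel_comp1 rel_1comp.

(* P is the set of letters, J the index set of the functors E^i. *)

Inductive form (P J : Type) : Type :=
| Letter of P
| Unit
| Tens of form P J & form P J
| Fun of J & form P J.

Arguments Letter {P J}.
Arguments Unit {P J}.
Arguments Tens {P J}.
Arguments Fun {P J}.

Declare Scope arr_scope.
Delimit Scope arr_scope with A.
Local Open Scope arr_scope.

Local Notation "A ** B" := (Tens A B) (at level 38, right associativity).

Inductive arr (P J : Type) : form P J -> form P J -> Type :=
| Id A : arr A A
| Comp A B C of arr B C & arr A B : arr A C
| TensA A B C D of arr A B & arr C D : arr (A ** C) (B ** D)
| FunA i A B of arr A B : arr (Fun i A) (Fun i B)
| Assoc A B C : arr ((A ** B) ** C) (A ** (B ** C))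
| AssocV A B C : arr (A ** (B ** C)) ((A ** B) ** C)
| Lunit A : arr (Unit ** A) A
| LunitV A : arr A (Unit ** A)
| Runit A : arr (A ** Unit) A
| RunitV A : arr A (A ** Unit)
| Sym A B : arr (A ** B) (B ** A)
| Diag A : arr A (A ** A)
| Term A : arr A Unit
| Psi i A B : arr (Fun i A ** Fun i B) (Fun i (A ** B))
| Psi0 i : arr Unit (Fun i Unit).

Arguments Id {P J} A.
Arguments Assoc {P J} A B C.
Arguments AssocV {P J} A B C.
Arguments Lunit {P J} A.
Arguments LunitV {P J} A.
Arguments Runit {P J} A.
Arguments RunitV {P J} A.
Arguments Sym {P J} A B.
Arguments Diag {P J} A.
Arguments Term {P J} A.
Arguments Psi {P J} i A B.
Arguments Psi0 {P J} i.

Local Notation "g 'o' f" := (Comp g f)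
  (at level 40, left associativity) : arr_scope.
Local Notation "f ## g" := (TensA f g)
  (at level 38, right associativity) : arr_scope.

Definition Mid (P J : Type) (A B C D : form P J) :
    arr ((A ** B) ** (C ** D)) ((A ** C) ** (B ** D)) :=
  AssocV A C (B ** D)
  o (Id A ## (Assoc C B D o (Sym B C ## Id D) o AssocV B C D))
  o Assoc A B (C ** D).

Reserved Notation "f ≡ g" (at level 70).

Inductive arr_eq (P J : Type) : forall A B : form P J,
    arr A B -> arr A B -> Prop :=
| arr_refl A B (f : arr A B) : f ≡ f
| arr_sym A B (f g : arr A B) : f ≡ g -> g ≡ f
| arr_trans A B (f g h : arr A B) : f ≡ g -> g ≡ h -> f ≡ h
| eq_Comp A B C (g g' : arr B C) (f f' : arr A B) :
    g ≡ g' -> f ≡ f' -> g o f ≡ g' o f'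
| eq_TensA A B C D (f f' : arr A B) (g g' : arr C D) :
    f ≡ f' -> g ≡ g' -> f ## g ≡ f' ## g'
| eq_FunA i A B (f f' : arr A B) : f ≡ f' -> FunA i f ≡ FunA i f'
| comp_assoc A B C D (h : arr C D) (g : arr B C) (f : arr A B) :
    h o (g o f) ≡ h o g o f
| comp_1l A B (f : arr A B) : Id B o f ≡ f
| comp_1r A B (f : arr A B) : f o Id A ≡ f
| tens_id A B : Id A ## Id B ≡ Id (A ** B)
| tens_comp A B C A' B' C' (g : arr B C) (f : arr A B)
    (g' : arr B' C') (f' : arr A' B') :
    (g o f) ## (g' o f') ≡ (g ## g') o (f ## f')
| fun_id i A : FunA i (Id A) ≡ Id (Fun i A)
| fun_comp i A B C (g : arr B C) (f : arr A B) :
    FunA i (g o f) ≡ FunA i g o FunA i f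
| nat_Assoc A B C A' B' C' (f : arr A A') (g : arr B B') (h : arr C C') :
    Assoc A' B' C' o ((f ## g) ## h) ≡ (f ## (g ## h)) o Assoc A B C
| nat_Lunit A B (f : arr A B) : Lunit B o (Id Unit ## f) ≡ f o Lunit A
| nat_Runit A B (f : arr A B) : Runit B o (f ## Id Unit) ≡ f o Runit A
| nat_Sym A B A' B' (f : arr A A') (g : arr B B') :
    Sym A' B' o (f ## g) ≡ (g ## f) o Sym A B
| nat_Diag A B (f : arr A B) : Diag B o f ≡ (f ## f) o Diag A
| nat_Psi i A B A' B' (f : arr A A') (g : arr B B') :
    Psi i A' B' o (FunA i f ## FunA i g) ≡ FunA i (f ## g) o Psi i A B
| AssocVK A B C : Assoc A B C o AssocV A B C ≡ Id (A ** (B ** C))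
| AssocK A B C : AssocV A B C o Assoc A B C ≡ Id ((A ** B) ** C)
| LunitVK A : Lunit A o LunitV A ≡ Id A
| LunitK A : LunitV A o Lunit A ≡ Id (Unit ** A)
| RunitVK A : Runit A o RunitV A ≡ Id A
| RunitK A : RunitV A o Runit A ≡ Id (A ** Unit)
| pentagon A B C D :
    Assoc A B (C ** D) o Assoc (A ** B) C D
    ≡ (Id A ## Assoc B C D) o Assoc A (B ** C) D o (Assoc A B C ## Id D)
| triangle A B :
    (Id A ## Lunit B) o Assoc A Unit B ≡ Runit A ## Id B
| hexagon A B C :
    Assoc B C A o Sym A (B ** C) o Assoc A B C
    ≡ (Id B ## Sym A C) o Assoc B A C o (Sym A B ## Id C)
| SymK A B : Sym B A o Sym A B ≡ Id (A ** B)
| Diag_assoc A :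
    Assoc A A A o (Diag A ## Id A) o Diag A ≡ (Id A ## Diag A) o Diag A
| Diag_Unit : Lunit Unit o Diag Unit ≡ Id Unit
| Diag_sym A : Sym A A o Diag A ≡ Diag A
| Diag_Tens A B : Diag (A ** B) ≡ Mid A A B B o (Diag A ## Diag B)
| Term_uniq A (f : arr A Unit) : f ≡ Term A
(* The counit laws, which make A ** B the product of A and B with diagonal
   Diag.  They do not follow from the equations above: on the category of sets
   with an idempotent e, with ** the cartesian product, x |-> (e x, e x) is a
   diagonal satisfying all of them although x |-> e x is not the identity. *)
| Diag_counitl A : Lunit A o (Term A ## Id A) o Diag A ≡ Id A
| Diag_counitr A : Runit A o (Id A ## Term A) o Diag A ≡ Id A
| Psi_assoc i A B C :
    FunA i (Assoc A B C) o Psi i (A ** B) C o (Psi i A B ## Id (Fun i C))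
    ≡ Psi i A (B ** C) o (Id (Fun i A) ## Psi i B C)
      o Assoc (Fun i A) (Fun i B) (Fun i C)
| Psi_Lunit i A :
    FunA i (Lunit A) o Psi i Unit A o (Psi0 i ## Id (Fun i A))
    ≡ Lunit (Fun i A)
| Psi_Runit i A :
    FunA i (Runit A) o Psi i A Unit o (Id (Fun i A) ## Psi0 i)
    ≡ Runit (Fun i A)
| Psi_Sym i A B :
    FunA i (Sym A B) o Psi i A B ≡ Psi i B A o Sym (Fun i A) (Fun i B)
| Psi_Diag i A : FunA i (Diag A) ≡ Psi i A A o Diag (Fun i A)
where "f ≡ g" := (arr_eq f g).

HB.instance Definition _ (P J : Type) (A B : form P J) :=
  gen_eqMixin (arr A B).
HB.instance Definition _ (P J : Type) (A B : form P J) :=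
  gen_choiceMixin (arr A B).

Section FreeCategory.
Variables P J : Type.
Implicit Types A B C D : form P J.

Definition arr_eqb A B : rel (arr A B) := fun f g => `[< arr_eq f g >].

Lemma arr_eqb_equiv A B : equiv_class_of (@arr_eqb A B).
Proof.
split=> [f|f g|g f h].
- by apply/asboolP; apply: arr_refl.
- by apply/asboolP/asboolP; apply: arr_sym.
- by move=> /asboolP fg /asboolP gh; apply/asboolP; apply: arr_trans fg gh.
Qed.

Canonical arr_equiv A B := EquivRelPack (@arr_eqb_equiv A B).

Definition free_hom A B := {eq_quot (arr_equiv A B)}%qT.

Definition class A B (f : arr A B) : free_hom A B := (\pi_(free_hom A B) f)%qT.

Lemma classP A B (f g : arr A B) : class f = class g <-> f ≡ g.
Proof.
split=> [/eqP|fg]; last by apply/eqP; rewrite eqmodE; apply/asboolP.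
by rewrite eqmodE => /asboolP.
Qed.

Lemma repr_class A B (f : arr A B) : repr (class f) ≡ f.
Proof. by apply/classP; rewrite /class reprK. Qed.

Lemma class_repr A B (f : free_hom A B) : class (repr f) = f.
Proof. exact: reprK. Qed.

Definition free_comp A B C (g : free_hom B C) (f : free_hom A B) :
  free_hom A C := class (repr g o repr f).

Lemma free_compE A B C (g : arr B C) (f : arr A B) :
  free_comp (class g) (class f) = class (g o f).
Proof. by apply/classP; apply: eq_Comp; apply: repr_class. Qed.

Lemma free_compA A B C D (h : free_hom C D) (g : free_hom B C)
    (f : free_hom A B) :
  free_comp h (free_comp g f) = free_comp (free_comp h g) f.
Proof.
rewrite -(class_repr f) -(class_repr g) -(class_repr h) !free_compE.
by apply/classP; apply: comp_assoc.
Qed.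

Lemma free_comp1 A B (f : free_hom A B) : free_comp (class (Id B)) f = f.
Proof.
by rewrite -(class_repr f) free_compE; apply/classP; apply: comp_1l.
Qed.

Lemma free_1comp A B (f : free_hom A B) : free_comp f (class (Id A)) = f.
Proof.
by rewrite -(class_repr f) free_compE; apply/classP; apply: comp_1r.
Qed.

Definition FreeCat : category :=
  Category free_compA free_comp1 free_1comp.

Fixpoint Gobj A : nat :=
  match A with
  | Letter _ => 1
  | Unit => 0
  | Tens A B => Gobj A + Gobj B
  | Fun _ A => (Gobj A).+1
  end.

Definition sym_fun m n k := if k < m then n + k else k - m.

(* For m = GA; it is only used on k < m + 2 + GB. *)
Definition psi_fun m k :=
  if k < m.+1 then k else if k == m.+1 then 0 else k.-1.

Fixpoint Garr A B (f : arr A B) : {set 'I_(Gobj A) * 'I_(Gobj B)} :=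
  match f with
  | Id A => rel_id (Gobj A)
  | Comp _ _ _ g f => rel_comp (Garr g) (Garr f)
  | TensA _ _ _ _ f g => rel_sum (Garr f) (Garr g)
  | FunA _ _ _ f => rel_up (Garr f)
  | Assoc _ _ _ => rel_fun _ _ id
  | AssocV _ _ _ => rel_fun _ _ id
  | Lunit _ => rel_fun _ _ id
  | LunitV _ => rel_fun _ _ id
  | Runit _ => rel_fun _ _ id
  | RunitV _ => rel_fun _ _ id
  | Sym A B => rel_fun _ _ (sym_fun (Gobj A) (Gobj B))
  | Diag A =>
      [set p : 'I__ * 'I__ |
         (p.2 == p.1 :> nat) || (p.2 == Gobj A + p.1 :> nat)]
  | Term _ => set0
  | Psi _ A _ => rel_fun _ _ (psi_fun (Gobj A))
  | Psi0 _ => set0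
  end.

(* pos A is the type of occurrences of generators in A; in terms of it, the
   invariance of Garr under arr_eq needs no arithmetic. *)

Fixpoint pos A : Type :=
  match A with
  | Letter _ => unit
  | Unit => Empty_set
  | Tens A B => pos A + pos B
  | Fun _ A => option (pos A)
  end.

Fixpoint num A : pos A -> 'I_(Gobj A) :=
  match A return pos A -> 'I_(Gobj A) with
  | Letter _ => fun _ => ord0
  | Unit => fun x => match x with end
  | Tens A B => fun x =>
      match x with
      | inl x => lshift _ (num x)
      | inr x => rshift _ (num x)
      end
  | Fun _ A => fun x => if x is Some x then lift ord0 (num x) else ord0
  end.

Lemma num_surj A (k : 'I_(Gobj A)) : exists x, num x = k.
Proof.
elim: A k => [p|[]//|A IA B IB|i A IA] /= k.
- by exists tt; rewrite ord1.
- case: (split_ordP k) => j ->.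
  + by have [x <-] := IA j; exists (inl x).
  + by have [x <-] := IB j; exists (inr x).
- case: (unliftP ord0 k) => [j ->|->]; last by exists None.
  by have [x <-] := IA j; exists (Some x).
Qed.

Lemma num_inj A : injective (@num A).
Proof.
elim: A => [p|[]|A IA B IB|i A IA] /=; first by do 2!case.
- move=> [x|x] [y|y].
  + by move/lshift_inj/IA->.
  + by move/eqP; rewrite eq_lrshift.
  + by move/eqP; rewrite eq_rlshift.
  + by move/rshift_inj/IB->.
- move=> [x|] [y|] //.
  by move/lift_inj/IA->.
Qed.

Definition pos_Assoc A B C (x : pos ((A ** B) ** C)) : pos (A ** (B ** C)) :=
  match x with
  | inl (inl x) => inl x
  | inl (inr x) => inr (inl x)
  | inr x => inr (inr x)
  end.

Definition pos_Psi (S T : Type) (x : option S + option T) : option (S + T) :=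
  match x with
  | inl (Some x) => Some (inl x)
  | inr (Some x) => Some (inr x)
  | _ => None
  end.

Fixpoint posrel A B (f : arr A B) : pos A -> pos B -> Prop :=
  match f in arr A B return pos A -> pos B -> Prop with
  | Id A => fun x y => x = y
  | Comp _ _ _ g f => fun x y => exists z, posrel f x z /\ posrel g z y
  | TensA _ _ _ _ f g => fun x y =>
      match x, y with
      | inl x, inl y => posrel f x y
      | inr x, inr y => posrel g x y
      | _, _ => False
      end
  | FunA _ _ _ f => fun x y =>
      match x, y with
      | None, None => True
      | Some x, Some y => posrel f x y
      | _, _ => False
      end
  | Assoc A B C => fun x y => @pos_Assoc A B C x = y
  | AssocV A B C => fun x y => x = @pos_Assoc A B C y
  | Lunit _ => fun x y => x = inr y
  | LunitV _ => fun x y => inr x = y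
  | Runit _ => fun x y => x = inl y
  | RunitV _ => fun x y => inl x = y
  | Sym A B => fun x y =>
      match x with inl x => inr x | inr x => inl x end = y
  | Diag A => fun x y => match y with inl y => y | inr y => y end = x
  | Term _ => fun x y => False
  | Psi _ _ _ => fun x y => pos_Psi x = y
  | Psi0 _ => fun x y => False
  end.

Lemma mem_rel_sum m n m' n' (R : {set 'I_m * 'I_n}) (S : {set 'I_m' * 'I_n'})
    (x : 'I_m + 'I_m') (y : 'I_n + 'I_n') :
  ((unsplit x, unsplit y) \in rel_sum R S)
  = match x, y with
    | inl x, inl y => (x, y) \in R
    | inr x, inr y => (x, y) \in S
    | _, _ => false
    end.
Proof.
rewrite inE; apply/orP/idP.
- by case=> /imsetP[[u v] /= uv [xu yv]]; move: uv;
    rewrite -(unsplitK x) -(unsplitK y); rewrite xu yv;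
    rewrite ?(unsplitK (inl _)) ?(unsplitK (inr _)).
- case: x y => x [] y //= xy; [left|right];
    by apply/imsetP; exists (x, y).
Qed.

Lemma mem_rel_up m n (R : {set 'I_m * 'I_n}) x y :
  ((lift ord0 x, lift ord0 y) \in rel_up R) = ((x, y) \in R).
Proof.
rewrite !inE /=; apply/imsetP/idP => [[[u v] uv [/= xu yv]]|xy].
  by rewrite (ord_inj xu) (ord_inj yv).
by exists (x, y).
Qed.

Lemma num_eq A (x y : pos A) : (num x == num y :> nat) <-> x = y.
Proof. by split=> [/eqP/val_inj/num_inj|->]. Qed.

Lemma rel_funP A B (h : nat -> nat) (x : pos A) (y y' : pos B) :
  h (num x) = num y' -> (num x, num y) \in rel_fun _ _ h <-> y' = y.
Proof. by rewrite inE /= => ->; apply: num_eq. Qed.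

Lemma rel_funVP A B (x x' : pos A) (y : pos B) :
  num y = num x' :> nat -> (num x, num y) \in rel_fun _ _ id <-> x = x'.
Proof. by rewrite inE /= => ->; apply: num_eq. Qed.

Lemma num_Assoc A B C (x : pos ((A ** B) ** C)) :
  num x = num (pos_Assoc x) :> nat.
Proof. by case: x => [[x|x]|x] //=; rewrite addnA. Qed.

Lemma GarrP A B (f : arr A B) (x : pos A) (y : pos B) :
  (num x, num y) \in Garr f <-> posrel f x y.
Proof.
elim: f x y => {A B}.
- move=> A x y; rewrite inE; exact: num_eq.
- move=> A B C g IHg f IHf x y; rewrite inE /=; split.
  + case/existsP=> k; have [z <-] := num_surj k.
    by case/andP=> /IHf xz /IHg zy; exists z.
  + case=> z [/IHf xz /IHg zy]; apply/existsP; exists (num z).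
    by rewrite xz.
- move=> A B C D f IHf g IHg x y /=.
  have := mem_rel_sum (Garr f) (Garr g)
    (match x with inl u => inl (num u) | inr u => inr (num u) end)
    (match y with inl u => inl (num u) | inr u => inr (num u) end).
  by case: x y => x [] y /= ->.
- move=> i A B f IHf [x|] [y|] /=.
  + by rewrite mem_rel_up.
  + by split=> //; rewrite !inE => /imsetP[].
  + by split=> //; rewrite !inE => /imsetP[].
  + by rewrite !inE eqxx.
- by move=> A B C x y; apply: rel_funP; apply: num_Assoc.
- by move=> A B C x y; apply: rel_funVP; apply: num_Assoc.
- by move=> A x y; apply: rel_funVP.
- by move=> A x y; apply: rel_funP.
- by move=> A x y; apply: rel_funVP.
- by move=> A x y; apply: rel_funP.
- move=> A B x y; apply: rel_funP; rewrite /sym_fun.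
  case: x => x /=; first by rewrite ltn_ord.
  by rewrite ltnNge leq_addr /= addKn.
- move=> A x [] y; rewrite inE /=.
  + by rewrite (ltn_eqF (ltn_addr _ (ltn_ord _))) orbF; apply: num_eq.
  + by rewrite gtn_eqF ?(ltn_addr _ (ltn_ord _)) // eqn_add2l; apply: num_eq.
- by move=> A x [].
- move=> i A B x y; apply: rel_funP; rewrite /psi_fun.
  case: x => [[x|]|[x|]] //=.
  + by rewrite ltnS ltn_ord.
  + rewrite -/(Gobj A) /bump /= !add1n !addnS !addSn /=.
    rewrite ltnNge leqW ?ltnS ?leq_addr //=.
    by rewrite eqSS gtn_eqF // ltnS leq_addr.
  + by rewrite addn0 ltnn eqxx.
- by move=> i [].
Qed.

Lemma ex_inl (S T : Type) (Q : S + T -> Prop) :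
  (exists x, Q (inl x)) -> exists x, Q x.
Proof. by case=> x; exists (inl x). Qed.

Lemma ex_inr (S T : Type) (Q : S + T -> Prop) :
  (exists x, Q (inr x)) -> exists x, Q x.
Proof. by case=> x; exists (inr x). Qed.

Lemma ex_Some (S : Type) (Q : option S -> Prop) :
  (exists x, Q (Some x)) -> exists x, Q x.
Proof. by case=> x; exists (Some x). Qed.

Local Ltac crush := repeat (match goal with
  | E : exists _, _ |- _ => destruct E
  | E : _ /\ _ |- _ => destruct E
  | E : sum _ _ |- _ => destruct E
  | E : option _ |- _ => destruct E
  | E : Empty_set |- _ => destruct E
  | E : False |- _ => destruct E
  | E : inl _ = inl _ |- _ => injection E as E
  | E : inr _ = inr _ |- _ => injection E as E
  | E : Some _ = Some _ |- _ => injection E as E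
  end; cbn in *; subst; try discriminate).

Local Ltac search := cbn; solve [
  match goal with
  | |- exists _ : sum _ _, _ =>
      (apply: ex_inl; search) || (apply: ex_inr; search)
  | |- exists _ : option _, _ =>
      (apply: ex_Some; search) || (exists None; search)
  | |- exists _, _ => eexists; search
  | |- _ /\ _ => split; search
  | |- _ => first [exact I | reflexivity | eassumption | congruence]
  end ].

Lemma posrel_sound A B (f g : arr A B) :
  f ≡ g -> forall x y, posrel f x y <-> posrel g x y.
Proof.
elim=> {A B f g}.
- by [].
- by move=> A B f g _ IH x y; rewrite IH.
- by move=> A B f g h _ IH1 _ IH2 x y; rewrite IH1.
- move=> A B C g g' f f' _ IHg _ IHf x y /=.
  by split=> -[z [/IHf xz /IHg zy]]; exists z.
- by move=> A B C D f f' g g' _ IHf _ IHg [x|x] [y|y] /=.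
- by move=> i A B f f' _ IHf [x|] [y|] /=.
all: by move=> *; cbn in *; split; intros; crush; search.
Qed.

Lemma Garr_sound A B (f g : arr A B) : f ≡ g -> Garr f = Garr g.
Proof.
move=> fg; apply/setP=> -[k l].
have [x <-] := num_surj k; have [y <-] := num_surj l.
by apply/idP/idP => /GarrP/(posrel_sound fg) ?; apply/GarrP.
Qed.

(* The choice of the representative is irrelevant by Gmap_class. *)
Definition Gmap A B (f : free_hom A B) : {set 'I_(Gobj A) * 'I_(Gobj B)} :=
  Garr (repr f).

Lemma Gmap_class A B (f : arr A B) : Gmap (class f) = Garr f.
Proof. exact/Garr_sound/repr_class. Qed.

Lemma Gmap1 A : Gmap (class (Id A)) = rel_id (Gobj A).
Proof. by rewrite Gmap_class. Qed.

Lemma GmapM A B C (g : free_hom B C) (f : free_hom A B) :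
  Gmap (free_comp g f) = rel_comp (Gmap g) (Gmap f).
Proof. by rewrite -(class_repr f) -(class_repr g) free_compE !Gmap_class. Qed.

Definition G : functor FreeCat Rel :=
  @Functor FreeCat Rel Gobj Gmap Gmap1 GmapM.

End FreeCategory.

(* Main.v *)
From Stdlib Require Import Setoid Morphisms.
From mathcomp Require Import all_boot.
From mathcomp Require Import boolp.
Require Import Defs.

Set Implicit Arguments.
Unset Strict Implicit.
Unset Printing Implicit Defensive.

Local Open Scope arr_scope.

Local Notation "A ** B" := (Tens A B) (at level 38, right associativity).
Local Notation "g 'o' f" := (Comp g f)
  (at level 40, left associativity) : arr_scope.
Local Notation "f ## g" := (TensA f g)
  (at level 38, right associativity) : arr_scope.
Local Notation "f ≡ g" := (arr_eq f g) (at level 70).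

(** Since the tensor is the categorical product, arrows can be analysed through
    the structure of their target.  An arrow into a letter is the projection to
    an occurrence of it, an arrow into the unit is unique, and an arrow into a
    tensor is a pair of arrows.  The remaining case is an arrow from A to
    E^i B.  Up to coherence A is a product of letters and of objects E^j A_k,
    and such an arrow has the form E^i h o sel_arr s, where s is a set of
    factors of A of the form E^i A_k and sel_arr s projects A to the selected
    factors and then merges their functor symbols with psi into E^i of the
    tensor of the A_k (psi_0 being the empty case).

    That every arrow has this form (all_normal) is proved by showing that the
    arrows of this form contain the identities and are closed under
    postcomposition with every arrow.  The essential case is composition with
    psi, that is, the product psi o <a, b> of two arrows into E^i.  Preorder
    the arrows from A into objects E^i B by letting a lie below b when
    a = E^i h o b for some h.  The axioms of a conjunctive relevant functor say
    that this product is then associative, commutative, idempotent and unital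
    with unit psi_0 o t, so that the product of two selections lies below a
    selection (sel_union).  Idempotence is the axiom about the diagonal.

    The relation of E^i h o sel_arr s determines s: a factor is selected exactly
    when its outermost functor symbol is related to that of the target
    (posrel_head, posrel_sel_head).  It then determines the relation of h, since
    apart from these symbols sel_arr s is a bijection from the positions inside
    the selected factors to those of the source of h (posrel_body).  Induction
    on the target, for all sources at once, gives faithfulness
    (posrel_complete). *)

#[local] Instance arr_eq_equivalence (P J : Type) (A B : form P J) :
  Equivalence (@arr_eq P J A B).
Proof.
split; [exact: arr_refl|exact: arr_sym|exact: arr_trans].
Qed.

#[local] Instance Comp_proper (P J : Type) (A B C : form P J) :
  Proper (@arr_eq P J B C ==> @arr_eq P J A B ==> @arr_eq P J A C)
    (@Comp P J A B C).
Proof. by move=> g g' gg' f f' ff'; apply: eq_Comp. Qed.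

#[local] Instance TensA_proper (P J : Type) (A B C D : form P J) :
  Proper (@arr_eq P J A B ==> @arr_eq P J C D ==> @arr_eq P J _ _)
    (@TensA P J A B C D).
Proof. by move=> f f' ff' g g' gg'; apply: eq_TensA. Qed.

#[local] Instance FunA_proper (P J : Type) (i : J) (A B : form P J) :
  Proper (@arr_eq P J A B ==> @arr_eq P J _ _) (@FunA P J i A B).
Proof. by move=> f f' ff'; apply: eq_FunA. Qed.

#[local] Hint Resolve arr_refl : core.

(** * Binary products *)

Section Products.
Variables P J : Type.
Implicit Types A B C D X Y : form P J.

Lemma compA A B C D (h : arr C D) (g : arr B C) (f : arr A B) :
  h o g o f ≡ h o (g o f).
Proof. by symmetry; apply: comp_assoc. Qed.

Definition Fst A B : arr (A ** B) A := Runit A o (Id A ## Term B).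
Definition Snd A B : arr (A ** B) B := Lunit B o (Term A ## Id B).
Definition pair X A B (f : arr X A) (g : arr X B) : arr X (A ** B) :=
  (f ## g) o Diag X.

#[local] Instance pair_proper X A B :
  Proper (@arr_eq P J X A ==> @arr_eq P J X B ==> @arr_eq P J _ _)
    (@pair X A B).
Proof. by move=> f f' ff' g g' gg'; rewrite /pair ff' gg'. Qed.

Lemma Term_eq A (f g : arr A Unit) : f ≡ g.
Proof. by rewrite (Term_uniq f) (Term_uniq g). Qed.

Lemma Fst_tens A B C D (f : arr A C) (g : arr B D) :
  Fst C D o (f ## g) ≡ f o Fst A B.
Proof.
rewrite /Fst (compA _ _ (f ## g)) -tens_comp comp_1l.
rewrite (Term_eq (Term D o g) (Id Unit o Term B)) -[X in X ## _]comp_1r.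
by rewrite tens_comp !comp_assoc nat_Runit.
Qed.

Lemma Snd_tens A B C D (f : arr A C) (g : arr B D) :
  Snd C D o (f ## g) ≡ g o Snd A B.
Proof.
rewrite /Snd (compA _ _ (f ## g)) -tens_comp comp_1l.
rewrite (Term_eq (Term C o f) (Id Unit o Term A)) -[X in _ ## X]comp_1r.
by rewrite tens_comp !comp_assoc nat_Lunit.
Qed.

Lemma Fst_pair X A B (f : arr X A) (g : arr X B) : Fst A B o pair f g ≡ f.
Proof.
by rewrite /pair comp_assoc Fst_tens /Fst compA Diag_counitr comp_1r.
Qed.

Lemma Snd_pair X A B (f : arr X A) (g : arr X B) : Snd A B o pair f g ≡ g.
Proof.
by rewrite /pair comp_assoc Snd_tens /Snd compA Diag_counitl comp_1r.
Qed.

Lemma pair_comp X Y A B (f : arr X A) (g : arr X B) (k : arr Y X) :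
  pair f g o k ≡ pair (f o k) (g o k).
Proof. by rewrite /pair compA nat_Diag tens_comp !compA. Qed.

Lemma tens_pair X A B C D (f : arr A C) (g : arr B D)
    (h : arr X A) (k : arr X B) :
  (f ## g) o pair h k ≡ pair (f o h) (g o k).
Proof. by rewrite /pair tens_comp compA. Qed.

(** In the formula for the diagonal of a tensor product the projections
    discard the two middle factors, which turns the symmetry exchanging them
    into an endomorphism of I ** I.  That object is terminal, being isomorphic
    to I, so the symmetry becomes an identity. *)
Lemma pair_Fst_Snd A B : pair (Fst A B) (Snd A B) ≡ Id (A ** B).
Proof.
have SymU : Sym Unit Unit ≡ Id (Unit ** Unit : form P J).
  rewrite -(comp_1l (Sym _ _)) -(LunitK Unit) compA.
  by rewrite (Term_eq (Lunit Unit o Sym _ _) (Lunit Unit)).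
have MidU : Mid A Unit Unit B ≡ Id _.
  rewrite /Mid SymU tens_id comp_1r AssocVK tens_id comp_1r.
  exact: AssocK.
have nat_Mid : ((Id A ## Term B) ## (Term A ## Id B)) o Mid A A B B
    ≡ Mid A Unit Unit B o ((Id A ## Term A) ## (Term B ## Id B)).
  have nat_AssocV X X' Y Y' Z Z' (f : arr X X') (g : arr Y Y') (h : arr Z Z') :
      ((f ## g) ## h) o AssocV X Y Z ≡ AssocV X' Y' Z' o (f ## (g ## h)).
    rewrite -(comp_1l (_ o AssocV X Y Z)) -AssocK compA (comp_assoc (Assoc _ _ _)).
    by rewrite nat_Assoc compA AssocVK comp_1r.
  rewrite /Mid !comp_assoc nat_AssocV !compA; apply: eq_Comp => //.
  rewrite nat_Assoc !comp_assoc; apply: eq_Comp => //.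
  rewrite -!tens_comp !comp_1l; apply: eq_TensA => //.
  rewrite !comp_assoc -nat_Assoc !compA; apply: eq_Comp => //.
  rewrite -nat_AssocV !comp_assoc; apply: eq_Comp => //.
  by rewrite -!tens_comp nat_Sym.
rewrite /pair Diag_Tens /Fst /Snd tens_comp comp_assoc compA compA.
rewrite (comp_assoc _ (Mid _ _ _ _)) nat_Mid MidU comp_1l comp_assoc.
by rewrite -!tens_comp Diag_counitr Diag_counitl tens_id.
Qed.

Lemma pair_eta X A B (f : arr X (A ** B)) :
  f ≡ pair (Fst A B o f) (Snd A B o f).
Proof. by rewrite -pair_comp pair_Fst_Snd comp_1l. Qed.

Lemma tens_pairE A B C D (f : arr A B) (g : arr C D) :
  f ## g ≡ pair (f o Fst A C) (g o Snd A C).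
Proof. by rewrite -tens_pair pair_Fst_Snd comp_1r. Qed.

Lemma Sym_pair X A B (f : arr X A) (g : arr X B) :
  Sym A B o pair f g ≡ pair g f.
Proof. by rewrite /pair comp_assoc nat_Sym compA Diag_sym. Qed.

(** Coassociativity of the diagonal, after naturality. *)
Lemma Assoc_pair X A B C (f : arr X A) (g : arr X B) (h : arr X C) :
  Assoc A B C o pair (pair f g) h ≡ pair f (pair g h).
Proof.
rewrite /pair -{1}(comp_1r h) -{2}(comp_1r f) !tens_comp.
by rewrite !comp_assoc nat_Assoc !compA -Diag_assoc !compA.
Qed.

Lemma AssocV_pair X A B C (f : arr X A) (g : arr X B) (h : arr X C) :
  AssocV A B C o pair f (pair g h) ≡ pair (pair f g) h.
Proof. by rewrite -Assoc_pair comp_assoc AssocK comp_1l. Qed.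

Lemma Lunit_pair X A (f : arr X Unit) (g : arr X A) : Lunit A o pair f g ≡ g.
Proof.
have := Snd_pair f g.
by rewrite /Snd (Term_eq (Term Unit) (Id _)) tens_id comp_1r.
Qed.

Lemma Runit_pair X A (f : arr X A) (g : arr X Unit) : Runit A o pair f g ≡ f.
Proof.
have := Fst_pair f g.
by rewrite /Fst (Term_eq (Term Unit) (Id _)) tens_id comp_1r.
Qed.

Lemma posrel_Fst A B (x : pos (A ** B)) y : posrel (Fst A B) x y <-> x = inl y.
Proof.
split=> [[[z|z] [xz zy]]|->]; last by exists (inl y).
- by case: x xz => [x|x] //= ->; case: zy => ->.
- by [].
Qed.

Lemma posrel_Snd A B (x : pos (A ** B)) y : posrel (Snd A B) x y <-> x = inr y.
Proof.
split=> [[[z|z] [xz zy]]|->]; last by exists (inr y).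
- by [].
- by case: x xz => [x|x] //= ->; case: zy => ->.
Qed.

End Products.

#[local] Existing Instance pair_proper.

(** * Arrows into a functor *)

Section IntoFunctor.
Variables (P J : Type) (i : J).
Implicit Types A B C D X Y : form P J.

(** Up to arrows under the functor, the arrows from a fixed object into values of
    the functor form a commutative idempotent monoid under this product: the
    axioms on psi, applied to pairs, are its laws. *)
Definition psi_prod X A B (a : arr X (Fun i A)) (b : arr X (Fun i B)) :
    arr X (Fun i (A ** B)) :=
  Psi i A B o pair a b.

#[local] Instance psi_prod_proper X A B :
  Proper (@arr_eq P J X _ ==> @arr_eq P J X _ ==> @arr_eq P J _ _)
    (@psi_prod X A B).
Proof. by move=> a a' aa' b b' bb'; rewrite /psi_prod aa' bb'. Qed.

(** Working with this preorder instead of naming the mediating arrows keeps the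
    coherence isomorphisms out of all later computations. *)
Definition factors X A B (a : arr X (Fun i A)) (b : arr X (Fun i B)) : Prop :=
  exists h : arr B A, a ≡ FunA i h o b.

Lemma factors_refl X A (a : arr X (Fun i A)) : factors a a.
Proof. by exists (Id A); rewrite fun_id comp_1l. Qed.

Lemma factors_trans X A B C (a : arr X (Fun i A)) (b : arr X (Fun i B))
    (c : arr X (Fun i C)) :
  factors a b -> factors b c -> factors a c.
Proof.
case=> h ab [k bc]; exists (h o k).
by rewrite ab bc fun_comp compA.
Qed.

Lemma factors_equiv X A B (a a' : arr X (Fun i A)) (b b' : arr X (Fun i B)) :
  a ≡ a' -> b ≡ b' -> factors a b -> factors a' b'.
Proof. by move=> aa' bb' [h ab]; exists h; rewrite -aa' -bb'. Qed.

Lemma factors_comp X Y A B (a : arr X (Fun i A)) (b : arr X (Fun i B))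
    (k : arr Y X) :
  factors a b -> factors (a o k) (b o k).
Proof. by case=> h ab; exists h; rewrite ab compA. Qed.

Lemma psi_prod_comp X Y A B (a : arr X (Fun i A)) (b : arr X (Fun i B))
    (k : arr Y X) :
  psi_prod a b o k ≡ psi_prod (a o k) (b o k).
Proof. by rewrite /psi_prod compA pair_comp. Qed.

Lemma psi_prodS X A B C D (a : arr X (Fun i A)) (b : arr X (Fun i B))
    (c : arr X (Fun i C)) (d : arr X (Fun i D)) :
  factors a c -> factors b d -> factors (psi_prod a b) (psi_prod c d).
Proof.
case=> h ac [k bd]; exists (h ## k).
by rewrite /psi_prod ac bd -tens_pair !comp_assoc nat_Psi.
Qed.

Lemma psi_prodA X A B C (a : arr X (Fun i A)) (b : arr X (Fun i B))
    (c : arr X (Fun i C)) :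
  factors (psi_prod a (psi_prod b c)) (psi_prod (psi_prod a b) c).
Proof.
exists (Assoc A B C); rewrite /psi_prod.
have Psi_pairl : pair (Psi i A B o pair a b) c
    ≡ (Psi i A B ## Id _) o pair (pair a b) c by rewrite tens_pair comp_1l.
have Psi_pairr : pair a (Psi i B C o pair b c)
    ≡ (Id _ ## Psi i B C) o pair a (pair b c) by rewrite tens_pair comp_1l.
by rewrite Psi_pairl Psi_pairr -Assoc_pair !comp_assoc Psi_assoc.
Qed.

Lemma psi_prodC X A B (a : arr X (Fun i A)) (b : arr X (Fun i B)) :
  factors (psi_prod a b) (psi_prod b a).
Proof.
by exists (Sym B A); rewrite /psi_prod comp_assoc Psi_Sym compA Sym_pair.
Qed.

Lemma psi_prod_idem X A (a : arr X (Fun i A)) : factors (psi_prod a a) a.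
Proof.
exists (Diag A).
by rewrite Psi_Diag compA nat_Diag /psi_prod /pair.
Qed.

(** The unit law relates the two sides by the left unit isomorphism, so each
    factors through the other. *)
Lemma psi_prod_unit_law X A (u : arr X Unit) (a : arr X (Fun i A)) :
  a ≡ FunA i (Lunit A) o psi_prod (Psi0 i o u) a.
Proof.
rewrite /psi_prod -[X in pair _ X]comp_1l -tens_pair !comp_assoc Psi_Lunit.
by rewrite compA; symmetry; apply: Lunit_pair.
Qed.

Lemma psi_prod_unitl X A (u : arr X Unit) (a : arr X (Fun i A)) :
  factors (psi_prod (Psi0 i o u) a) a.
Proof.
exists (LunitV A).
by rewrite {2}(psi_prod_unit_law u a) comp_assoc -fun_comp LunitK fun_id comp_1l.
Qed.

Lemma psi_prod_unitlV X A (u : arr X Unit) (a : arr X (Fun i A)) :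
  factors a (psi_prod (Psi0 i o u) a).
Proof. by exists (Lunit A); apply: psi_prod_unit_law. Qed.

(** The converse of associativity follows from commutativity. *)
Lemma psi_prodAV X A B C (a : arr X (Fun i A)) (b : arr X (Fun i B))
    (c : arr X (Fun i C)) :
  factors (psi_prod (psi_prod a b) c) (psi_prod a (psi_prod b c)).
Proof.
apply: factors_trans (psi_prodC _ _) _.
apply: factors_trans (psi_prodS (factors_refl c) (psi_prodC a b)) _.
apply: factors_trans (psi_prodA _ _ _) _.
apply: factors_trans (psi_prodC _ _) _.
exact: psi_prodS (factors_refl a) (psi_prodC c b).
Qed.

Lemma psi_prodACA X A B C D (a : arr X (Fun i A)) (b : arr X (Fun i B))
    (c : arr X (Fun i C)) (d : arr X (Fun i D)) :
  factors (psi_prod (psi_prod a b) (psi_prod c d))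
    (psi_prod (psi_prod a c) (psi_prod b d)).
Proof.
apply: factors_trans (psi_prodAV _ _ _) _.
apply: factors_trans (psi_prodA _ _ _).
apply: psi_prodS (factors_refl a) _.
apply: factors_trans (psi_prodA _ _ _) _.
apply: factors_trans (psi_prodAV _ _ _).
exact: psi_prodS (psi_prodC b c) (factors_refl d).
Qed.

(** The sets of tensor factors of A of the form E^i A_k.  Membership is recorded
    by an equality of indices because equality on J need not be decidable; as
    these proofs are unique, each set has exactly one code.  Letters and the unit
    offer nothing to select. *)
Fixpoint sel A : Type :=
  match A with
  | Letter _ => unit
  | Unit => unit
  | A ** B => sel A * sel B
  | Fun j _ => option (i = j)
  end.

Fixpoint sel_obj A : sel A -> form P J :=
  match A return sel A -> form P J with
  | Letter _ => fun=> Unit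
  | Unit => fun=> Unit
  | A ** B => fun s => sel_obj s.1 ** sel_obj s.2
  | Fun _ A => fun s => if s is Some _ then A else Unit
  end.

Fixpoint sel_arr A : forall s : sel A, arr A (Fun i (sel_obj s)) :=
  match A return forall s : sel A, arr A (Fun i (sel_obj s)) with
  | Letter p => fun=> Psi0 i o Term (Letter p)
  | Unit => fun=> Psi0 i o Term Unit
  | A ** B => fun s =>
      Psi i (sel_obj s.1) (sel_obj s.2) o (sel_arr s.1 ## sel_arr s.2)
  | Fun j A => fun s =>
      match s return arr (Fun j A) (Fun i (if s is Some _ then A else Unit)) with
      | Some e =>
          match e in _ = k return arr (Fun k A) (Fun i A) with
          | erefl => Id (Fun i A)
          end
      | None => Psi0 i o Term (Fun j A)
      end
  end.

Lemma sel_arr_Tens A B (s : sel A) (t : sel B) :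
  @sel_arr (A ** B) (s, t)
    ≡ psi_prod (sel_arr s o Fst A B) (sel_arr t o Snd A B).
Proof. by rewrite /= tens_pairE. Qed.

Fixpoint sel_none A : sel A :=
  match A return sel A with
  | Letter _ => tt
  | Unit => tt
  | A ** B => (sel_none A, sel_none B)
  | Fun _ _ => None
  end.

Lemma sel_none_arr A : factors (Psi0 i o Term A) (sel_arr (sel_none A)).
Proof.
elim: A => [p||A IHA B IHB|j A _]; try exact: factors_refl.
have Psi0_comp X Y (f : arr X Y) : (Psi0 i o Term Y) o f ≡ Psi0 i o Term X.
  by rewrite compA (Term_uniq (_ o f)).
apply: factors_equiv (arr_refl _) (arr_sym (sel_arr_Tens _ _)) _.
apply: factors_trans _ (psi_prodS (factors_comp (Fst A B) IHA)
  (factors_comp (Snd A B) IHB)).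
apply: factors_equiv
  (psi_prod_unitlV (Term (A ** B)) (Psi0 i o Term (A ** B))) => //.
by rewrite !Psi0_comp.
Qed.

Lemma sel_Fst A B (s : sel A) :
  factors (sel_arr s o Fst A B) (@sel_arr (A ** B) (s, sel_none B)).
Proof.
apply: factors_equiv (arr_refl _) (arr_sym (sel_arr_Tens _ _)) _.
apply: factors_trans (psi_prod_unitlV (Term B o Snd A B) _) _.
apply: factors_trans (psi_prodC _ _) (psi_prodS (factors_refl _) _).
apply: factors_equiv (factors_comp (Snd A B) (sel_none_arr B)) => //.
exact: compA.
Qed.

Lemma sel_Snd A B (s : sel B) :
  factors (sel_arr s o Snd A B) (@sel_arr (A ** B) (sel_none A, s)).
Proof.
apply: factors_equiv (arr_refl _) (arr_sym (sel_arr_Tens _ _)) _.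
apply: factors_trans (psi_prod_unitlV (Term A o Fst A B) _) _.
apply: psi_prodS (factors_refl _).
apply: factors_equiv (factors_comp (Fst A B) (sel_none_arr A)) => //.
exact: compA.
Qed.

(** A factor selected on both sides is merged by idempotence, one selected on
    neither or only one side by the unit law, and the factors of a tensor are
    brought together by the interchange law. *)
Lemma sel_union A (s t : sel A) :
  exists u : sel A, factors (psi_prod (sel_arr s) (sel_arr t)) (sel_arr u).
Proof.
elim: A s t => [p||A IHA B IHB|j A _].
- by move=> s t; exists tt; apply: psi_prod_unitl.
- by move=> s t; exists tt; apply: psi_prod_unitl.
- move=> [s1 s2] [t1 t2].
  have [u1 h1] := IHA s1 t1; have [u2 h2] := IHB s2 t2; exists (u1, u2).
  apply: (@factors_equiv _ _ _
    (psi_prod (psi_prod (sel_arr s1 o Fst A B) (sel_arr s2 o Snd A B))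
              (psi_prod (sel_arr t1 o Fst A B) (sel_arr t2 o Snd A B))) _
    (psi_prod (sel_arr u1 o Fst A B) (sel_arr u2 o Snd A B))).
  + by rewrite /psi_prod !sel_arr_Tens.
  + by rewrite sel_arr_Tens.
  apply: factors_trans (psi_prodACA _ _ _ _) _; apply: psi_prodS.
  + apply: factors_equiv (psi_prod_comp _ _ _) (arr_refl _) _.
    exact: factors_comp h1.
  + apply: factors_equiv (psi_prod_comp _ _ _) (arr_refl _) _.
    exact: factors_comp h2.
- move=> [e|] t.
  + case: t => [e'|]; exists (Some e).
    * rewrite (Prop_irrelevance e' e); exact: psi_prod_idem.
    * apply: factors_trans (psi_prodC _ _) _; exact: psi_prod_unitl.
  + by exists t; apply: psi_prod_unitl.
Qed.

(** Every position in the source of an arrow h comes from a position of A, and by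
    posrel_sel_fun the latter leads nowhere else.  Hence the relation of
    FunA i h o sel_arr s determines that of h. *)
Lemma posrel_sel_total A (s : sel A) (y : pos (sel_obj s)) :
  exists x, posrel (sel_arr s) x (Some y).
Proof.
elim: A s y => [p||A IHA B IHB|j A _].
- by move=> s [].
- by move=> s [].
- move=> [s1 s2] [y|y].
  + have [x xy] := IHA _ y; exists (inl x); by exists (inl (Some y)).
  + have [x xy] := IHB _ y; exists (inr x); by exists (inr (Some y)).
- move=> [e|] // y; case: _ / e y => y /=.
  by exists (Some y).
Qed.

Lemma posrel_sel_fun A (s : sel A) x y y' :
  posrel (sel_arr s) x y -> posrel (sel_arr s) x y' -> y = y'.
Proof.
elim: A s x y y' => [p||A IHA B IHB|j A _].
- by move=> s x y y' /= [? [[]]].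
- by move=> s [].
- move=> [s1 s2] [x|x] y y' /= [[z|z] [//= xz <-]] [[z'|z'] [//= xz' <-]].
  + by rewrite (IHA _ _ _ _ xz xz').
  + by rewrite (IHB _ _ _ _ xz xz').
- move=> [e|] x y y' /=; last by case=> ? [[]].
  by case: _ / e y y' => y y' <-.
Qed.

(** The position None of the target is the merged functor symbol; the positions
    related to it are the outermost symbols of the selected factors. *)
Lemma posrel_sel_head A (s t : sel A) :
  (forall x, posrel (sel_arr s) x None <-> posrel (sel_arr t) x None) -> s = t.
Proof.
have Tens_inl B C (u : sel B) (v : sel C) x :
    posrel (@sel_arr (B ** C) (u, v)) (inl x) None
    <-> posrel (sel_arr u) x None.
  split=> [[[[z|]|z] []//]|xN]; by exists (inl None).
have Tens_inr B C (u : sel B) (v : sel C) x :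
    posrel (@sel_arr (B ** C) (u, v)) (inr x) None
    <-> posrel (sel_arr v) x None.
  split=> [[[z|[z|]] []//]|xN]; by exists (inr None).
elim: A s t => [p||A IHA B IHB|j A _].
- by move=> [] [].
- by move=> [] [].
- move=> [s1 s2] [t1 t2] st; congr (_, _).
  + apply: IHA => x.
    apply: (iff_trans (iff_sym (Tens_inl _ _ _ _ _))).
    exact: (iff_trans (st _) (Tens_inl _ _ _ _ _)).
  + apply: IHB => x.
    apply: (iff_trans (iff_sym (Tens_inr _ _ _ _ _))).
    exact: (iff_trans (st _) (Tens_inr _ _ _ _ _)).
- have head (e : i = j) : posrel (@sel_arr (Fun j A) (Some e)) None None.
    by case: _ / e.
  have nohead x : ~ posrel (@sel_arr (Fun j A) None) x None by case=> ? [].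
  move=> [e|] [e'|] // st.
  + by rewrite (Prop_irrelevance e e').
  + by case: (nohead None); apply/st.
  + by case: (nohead None); apply/st.
Qed.

End IntoFunctor.

(** * Arrows into a letter *)

Section IntoLetter.
Variables (P J : Type) (p : P).
Implicit Types A B : form P J.

Fixpoint occ A : Type :=
  match A with
  | Letter q => p = q
  | Unit => Empty_set
  | A ** B => occ A + occ B
  | Fun _ _ => Empty_set
  end.

Fixpoint occ_arr A : occ A -> arr A (Letter p) :=
  match A return occ A -> arr A (Letter p) with
  | Letter q => fun e =>
      match e in _ = r return arr (Letter r) (Letter p) with
      | erefl => Id (Letter p)
      end
  | Unit => fun l => match l with end
  | A ** B => fun l =>
      match l with
      | inl l => occ_arr l o Fst A B
      | inr l => occ_arr l o Snd A B
      end
  | Fun _ _ => fun l => match l with end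
  end.

Lemma posrel_occ_total A (l : occ A) : exists x, posrel (occ_arr l) x tt.
Proof.
elim: A l => [q|[]|A IHA B IHB|j A _ []].
- by move=> e; case: _ / e; exists tt.
- case=> l.
  + have [x xl] := IHA l; exists (inl x), x; split=> //; exact/posrel_Fst.
  + have [x xl] := IHB l; exists (inr x), x; split=> //; exact/posrel_Snd.
Qed.

Lemma posrel_occ_inj A (l m : occ A) x :
  posrel (occ_arr l) x tt -> posrel (occ_arr m) x tt -> l = m.
Proof.
elim: A l m x => [q|[]|A IHA B IHB|j A _ []].
- by move=> e e' *; exact: (@Prop_irrelevance (p = q) e e').
- move=> [l|l] [m|m] x [z [xz zl]] [z' [xz' zm]].
  + move: (proj1 (posrel_Fst _ _) xz)
      (proj1 (posrel_Fst _ _) xz').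
    by move=> -> [ez]; rewrite (IHA l m z) // ez.
  + move: (proj1 (posrel_Fst _ _) xz)
      (proj1 (posrel_Snd _ _) xz').
    by move=> ->.
  + move: (proj1 (posrel_Snd _ _) xz)
      (proj1 (posrel_Fst _ _) xz').
    by move=> ->.
  + move: (proj1 (posrel_Snd _ _) xz)
      (proj1 (posrel_Snd _ _) xz').
    by move=> -> [ez]; rewrite (IHB l m z) // ez.
Qed.

End IntoLetter.

(** * Normal forms *)

Section NormalForms.
Variables P J : Type.
Implicit Types A B C X : form P J.

(** Below a functor nothing is required of the mediating arrow: only the outermost
    layer of an arrow is normalised, and the induction in posrel_complete
    reaches the inner ones. *)
Fixpoint normal X B : arr X B -> Prop :=
  match B return arr X B -> Prop with
  | Letter p => fun f => exists l : occ p X, f ≡ occ_arr l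
  | Unit => fun=> True
  | A ** B => fun f => normal (Fst A B o f) /\ normal (Snd A B o f)
  | Fun i B => fun f => exists s : sel i X, factors f (sel_arr s)
  end.

Lemma normal_equiv X B (f g : arr X B) : f ≡ g -> normal f -> normal g.
Proof.
elim: B f g => [p||A IHA B IHB|i B _] //= f g fg.
- by case=> l fl; exists l; rewrite -fg.
- case=> f1 f2; split; [apply: IHA f1|apply: IHB f2]; by rewrite fg.
- by case=> s fs; exists s; apply: factors_equiv fs.
Qed.

Lemma normal_pair X A B (f : arr X A) (g : arr X B) :
  normal f -> normal g -> normal (pair f g).
Proof.
move=> nf ng; split.
- by apply: normal_equiv nf; rewrite Fst_pair.
- by apply: normal_equiv ng; rewrite Snd_pair.
Qed.

(** Postcomposition makes each generating arrow easy: the structural arrows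
    permute, copy or delete the components of a normal arrow, an arrow under a
    functor is absorbed by the mediating arrow, and psi multiplies two
    components, which is where selections are united. *)
Lemma normal_comp X A B (g : arr A B) (f : arr X A) :
  normal f -> normal (g o f).
Proof.
elim: g X f => {A B}.
- by move=> A X f; apply: normal_equiv; rewrite comp_1l.
- move=> A B C g IHg h IHh X f /IHh /IHg.
  by apply: normal_equiv; rewrite compA.
- move=> A B C D g IHg h IHh X f [/IHg n1 /IHh n2].
  apply: normal_equiv (normal_pair n1 n2).
  by rewrite -tens_pair -pair_eta.
- move=> i A B g _ X f [s [h fs]]; exists s, (g o h).
  by rewrite fs fun_comp compA.
- move=> A B C X f [[n1 n2] n3].
  apply: normal_equiv (normal_pair n1 (normal_pair n2 n3)).
  by rewrite -Assoc_pair -!pair_eta.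
- move=> A B C X f [n1 [n2 n3]].
  apply: normal_equiv (normal_pair (normal_pair n1 n2) n3).
  by rewrite -AssocV_pair -!pair_eta.
- move=> A X f [_ n]; apply: normal_equiv n.
  by rewrite [X in _ ≡ _ o X]pair_eta Lunit_pair.
- move=> A X f n; apply: normal_equiv (normal_pair (f := Term X) I n).
  rewrite -[in X in _ ≡ X](Lunit_pair (Term X) f) comp_assoc LunitK.
  by rewrite comp_1l.
- move=> A X f [n _]; apply: normal_equiv n.
  by rewrite [X in _ ≡ _ o X]pair_eta Runit_pair.
- move=> A X f n; apply: normal_equiv (normal_pair (g := Term X) n I).
  rewrite -[in X in _ ≡ X](Runit_pair f (Term X)) comp_assoc RunitK.
  by rewrite comp_1l.
- move=> A B X f [n1 n2]; apply: normal_equiv (normal_pair n2 n1).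
  by rewrite -Sym_pair -pair_eta.
- move=> A X f n; apply: normal_equiv (normal_pair n n).
  by rewrite nat_Diag /pair.
- by [].
- move=> i A B X f [[s fs] [t ft]].
  have [u stu] := sel_union s t; exists u.
  apply: factors_equiv (factors_trans (psi_prodS fs ft) stu) => //.
  by rewrite /psi_prod -pair_eta.
- move=> i X f _; exists (sel_none i X).
  apply: factors_equiv (sel_none_arr i X) => //.
  by rewrite (Term_uniq f).
Qed.

(** The identity of a tensor is the pair of its projections, so its normality needs
    normal arrows to be stable under precomposition with projections. *)
Lemma normal_Fst A B C (f : arr A C) : normal f -> normal (f o Fst A B).
Proof.
elim: C f => [p||C IHC D IHD|i C _] //= f.
- by case=> l fl; exists (inl l); rewrite fl.
- case=> /IHC n1 /IHD n2.
  by split; [apply: normal_equiv n1|apply: normal_equiv n2]; rewrite compA.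
- case=> s fs; exists (s, sel_none i B).
  exact: factors_trans (factors_comp _ fs) (sel_Fst _ _).
Qed.

Lemma normal_Snd A B C (f : arr B C) : normal f -> normal (f o Snd A B).
Proof.
elim: C f => [p||C IHC D IHD|i C _] //= f.
- by case=> l fl; exists (inr l); rewrite fl.
- case=> /IHC n1 /IHD n2.
  by split; [apply: normal_equiv n1|apply: normal_equiv n2]; rewrite compA.
- case=> s fs; exists (sel_none i A, s).
  exact: factors_trans (factors_comp _ fs) (sel_Snd _ _).
Qed.

Lemma normal_Id A : normal (Id A).
Proof.
elim: A => [p||A IHA B IHB|i A _] //.
- by exists (erefl p).
- split.
  + by apply: normal_equiv (normal_Fst B IHA); rewrite comp_1l comp_1r.
  + by apply: normal_equiv (normal_Snd A IHB); rewrite comp_1l comp_1r.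
- by exists (Some erefl : sel i (Fun i A)); apply: factors_refl.
Qed.

Lemma all_normal A B (f : arr A B) : normal f.
Proof.
apply: normal_equiv (comp_1r f) _; exact: normal_comp (normal_Id A).
Qed.

End NormalForms.

(** * Faithfulness *)

Section Faithfulness.
Variables P J : Type.
Implicit Types A B C X : form P J.

Lemma posrel_head i X B (f : arr X (Fun i B)) (s : sel i X) h x :
  f ≡ FunA i h o sel_arr s ->
  posrel f x None <-> posrel (sel_arr s) x None.
Proof.
move=> E; rewrite (posrel_sound E); split=> [[[z|] []//]|sx].
by exists None.
Qed.

Lemma posrel_body i X B (f : arr X (Fun i B)) (s : sel i X) h x z y :
  f ≡ FunA i h o sel_arr s -> posrel (sel_arr s) x (Some z) ->
  posrel f x (Some y) <-> posrel h z y.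
Proof.
move=> E xz; rewrite (posrel_sound E); split=> [[[z'|] [//xz' zy]]|zy].
- by have [->] := posrel_sel_fun xz xz'.
- by exists (Some z).
Qed.

(** The induction is on the target with the source arbitrary: under a functor the
    source changes from A to the tensor of the selected factors. *)
Lemma posrel_complete A B (f g : arr A B) :
  (forall x y, posrel f x y <-> posrel g x y) -> f ≡ g.
Proof.
elim: B A f g => [p||B IHB C IHC|i B IHB] A f g fg.
- have [l fl] := all_normal f; have [m gm] := all_normal g.
  have [x xl] := posrel_occ_total l.
  rewrite fl gm (@posrel_occ_inj _ _ p A l m x) //.
  by apply/(posrel_sound gm)/fg/(posrel_sound fl).
- exact: Term_eq.
- have proj : forall (D E : form P J) (k : arr D E) (f g : arr A D),
      (forall x y, posrel f x y <-> posrel g x y) ->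
      forall x y, posrel (k o f) x y <-> posrel (k o g) x y.
    by move=> D E k f' g' fg' x y; split=> -[z [/fg' xz zy]]; exists z.
  rewrite (pair_eta f) (pair_eta g).
  by rewrite (IHB _ _ _ (proj _ _ (Fst B C) _ _ fg))
             (IHC _ _ _ (proj _ _ (Snd B C) _ _ fg)).
- have [s [h fE]] := all_normal f; have [t [k gE]] := all_normal g.
  have st : s = t.
    apply: posrel_sel_head => x.
    by rewrite -(posrel_head x fE) -(posrel_head x gE).
  subst t; rewrite fE gE (IHB _ h k) // => z y.
  have [x xz] := posrel_sel_total z.
  by rewrite -(posrel_body y fE xz) -(posrel_body y gE xz).
Qed.

End Faithfulness.

Theorem mainTheorem8 (P J : Type) : faithful (G P J).
Proof.
move=> A B f g /= fg.
rewrite -(class_repr f) -(class_repr g); apply/classP/posrel_complete => x y.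
move: fg; rewrite /Gmap => fg.
by split=> /GarrP xy; apply/GarrP; rewrite ?fg // -fg.
Qed.
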